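(* There exists a one-sided error non-adaptive property testing algorithm for the property of having binary rank at most $d$ whose query complexity is $O(2^{2d}/\epsilon^2)$, and there exists a one-sided error adaptive property testing algorithm for the property of having binary rank at most $d$ whose query complexity is $O(2^{2d}/\epsilon)$. Here a testing algorithm, given $d$, $\epsilon$ and query access to an $n\times n$ $(0,1)$-matrix $M$, always accepts if $M$ has binary rank at most $d$ and rejects with probability at least $2/3$ if $M$ is $\epsilon$-far from binary rank at most $d$.
   Context: The binary rank of a $(0,1)$-matrix $M$ of size $n\times n$ is the minimal $r$ such that $M=X\cdot Y$ with $X$ an $n\times r$ and $Y$ an $r\times n$ $(0,1)$-matrix, where the operations are over the reals; equivalently, the minimal number of all-ones combinatorial rectangles (submatrices on a set of rows times a set of columns) needed to partition the $1$-entries of $M$. $M$ is $\epsilon$-far from binary rank at most $d$ if more than $\epsilon n^2$ entries must be modified to obtain a $(0,1)$-matrix of binary rank at most $d$. A testing algorithm accesses $M$ only by querying single entries; one-sided error means matrices with the property are accepted with probability 1; non-adaptive means all queries are chosen in advance. Query complexity is the number of queried entries. *)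

(* Defs.v *)
From mathcomp Require Import all_boot all_order all_algebra.
From mathcomp Require Import reals.

Set Implicit Arguments.
Unset Strict Implicit.
Unset Printing Implicit Defensive.

Import Order.TTheory GRing.Theory Num.Theory.
Local Open Scope ring_scope.

(* (0,1)-matrices are boolean matrices. They must be embedded in R before being
   multiplied: the ring structure of bool is that of the field with two
   elements, whereas the product X *m Y below is taken over the reals. *)
Definition real_mx (R : realType) (m n : nat) (M : 'M[bool]_(m, n)) : 'M[R]_(m, n) :=
  map_mx (fun b : bool => b%:R) M.

Arguments real_mx R {m n} M.

Definition has_binary_factorization (R : realType) (n : nat) (M : 'M[bool]_n)
    (r : nat) : bool :=
  [exists X : 'M[bool]_(n, r), exists Y : 'M[bool]_(r, n),
     real_mx R M == real_mx R X *m real_mx R Y].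

Arguments has_binary_factorization R {n} M r.

Lemma has_binary_factorization_ex (R : realType) (n : nat) (M : 'M[bool]_n) :
  exists r : nat, has_binary_factorization R M r.
Proof.
exists n; apply/existsP; exists M; apply/existsP.
exists (\matrix_(i, j) (i == j)); apply/eqP.
rewrite (_ : real_mx R (\matrix_(i, j) (i == j)) = 1%:M) ?mulmx1 //.
by apply/matrixP => i j; rewrite !mxE.
Qed.

Definition binary_rank (R : realType) (n : nat) (M : 'M[bool]_n) : nat :=
  ex_minn (has_binary_factorization_ex R M).

Arguments binary_rank R {n} M.

Definition mx_dist (n : nat) (M N : 'M[bool]_n) : nat :=
  #|[set ij : 'I_n * 'I_n | M ij.1 ij.2 != N ij.1 ij.2]|.

Definition far_from_binary_rank (R : realType) (n d : nat) (eps : R)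
    (M : 'M[bool]_n) : Prop :=
  forall N : 'M[bool]_n, (binary_rank R N <= d)%N ->
    eps * n%:R ^+ 2 < (mx_dist M N)%:R.

(* A deterministic query algorithm on n x n matrices: it either halts with a
   verdict (true = accept), or queries an entry and continues with the first
   (resp. second) subtree if the answer is 0 (resp. 1). *)
Inductive query_tree (n : nat) : Type :=
| Halt of bool
| Query of 'I_n * 'I_n & query_tree n & query_tree n.

Fixpoint accepts (n : nat) (t : query_tree n) (M : 'M[bool]_n) : bool :=
  match t with
  | Halt b => b
  | Query ij t0 t1 => accepts (if M ij.1 ij.2 then t1 else t0) M
  end.

Fixpoint queried (n : nat) (t : query_tree n) (M : 'M[bool]_n) :
    seq ('I_n * 'I_n) :=
  match t with
  | Halt _ => [::]
  | Query ij t0 t1 => ij :: queried (if M ij.1 ij.2 then t1 else t0) M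
  end.

(* A randomized query algorithm is a finitely supported distribution on
   deterministic ones, presented by a random seed. *)
Record randomized_algorithm (R : realType) (n : nat) : Type := RandomizedAlgorithm {
  seed : finType;
  seed_prob : seed -> R;
  seed_prob_ge0 : forall w : seed, 0 <= seed_prob w;
  seed_prob_sum1 : \sum_(w : seed) seed_prob w = 1;
  run : seed -> query_tree n
}.

Definition prob_accept (R : realType) (n : nat) (A : randomized_algorithm R n)
    (M : 'M[bool]_n) : R :=
  \sum_(w : seed A | accepts (run w) M) seed_prob w.

Definition prob_reject (R : realType) (n : nat) (A : randomized_algorithm R n)
    (M : 'M[bool]_n) : R :=
  \sum_(w : seed A | ~~ accepts (run w) M) seed_prob w.

Definition one_sided_tester (R : realType) (n d : nat) (eps : R)
    (A : randomized_algorithm R n) : Prop :=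
  (forall M : 'M[bool]_n, (binary_rank R M <= d)%N -> prob_accept A M = 1) /\
  (forall M : 'M[bool]_n, far_from_binary_rank d eps M ->
     2%:R / 3%:R <= prob_reject A M).

(* Once the seed is drawn, the queries do not depend on the answers. *)
Definition nonadaptive (R : realType) (n : nat) (A : randomized_algorithm R n) : Prop :=
  forall (w : seed A) (M N : 'M[bool]_n), queried (run w) M = queried (run w) N.

(* Worst case over seeds and inputs; repeated queries are counted repeatedly. *)
Definition query_complexity_le (R : realType) (n : nat)
    (A : randomized_algorithm R n) (q : R) : Prop :=
  forall (w : seed A) (M : 'M[bool]_n), (size (queried (run w) M))%:R <= q.

(* Main.v *)
(* A matrix of binary rank at most [d] has at most [2 ^ d] distinct rows and
   columns.  Keep a set [A] of rows and a set [B] of columns, pairwise distinct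
   on the submatrix [A x B], and sample uniform pairs [(i, j)].  A pair makes
   progress, i.e. allows [A] or [B] to grow, when row [i] is new on [B], or
   column [j] is new on [A], or [M i j] differs from [M a b] for the
   representatives [a] of [i] and [b] of [j].  As long as [A x B] can be
   completed to a matrix [N] of binary rank at most [d], the other pairs agree
   with a blow-up of [N], so that a pair makes progress with probability more
   than [eps] if [M] is far; and [#|A| + #|B|] cannot exceed [2 ^ (d + 1)].
   Hence [O(2 ^ d / eps)] samples suffice.  The adaptive tester queries row [i]
   on [B] and column [j] on [A] only, the nonadaptive one the whole submatrix
   spanned by the samples, which contains the final [A x B]. *)
Require Import Defs.
From mathcomp Require Import all_boot all_order all_algebra.
From mathcomp Require Import reals.
From mathcomp Require Import lra zify.

Import Order.TTheory GRing.Theory Num.Theory.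
Local Open Scope ring_scope.

(** * Binary rank under transposition and index substitution *)

Lemma binary_rank_leP (R : realType) (n d : nat) (M : 'M[bool]_n) :
  reflect (exists2 r, (r <= d)%N & has_binary_factorization R M r)
          (binary_rank R M <= d)%N.
Proof.
rewrite /binary_rank; case: ex_minnP => r0 fact_r0 min_r0.
apply: (iffP idP) => [le_r0d | [r le_rd fact_r]]; first by exists r0.
exact: leq_trans (min_r0 _ fact_r) le_rd.
Qed.

Lemma binary_rank_tr (R : realType) (n : nat) (M : 'M[bool]_n) (d : nat) :
  (binary_rank R M <= d)%N -> (binary_rank R M^T <= d)%N.
Proof.
case/binary_rank_leP => r le_rd /existsP[X /existsP[Y /eqP defM]].
apply/binary_rank_leP; exists r => //.
apply/existsP; exists Y^T; apply/existsP; exists X^T.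
by rewrite /real_mx -!map_trmx -trmx_mul -[map_mx _ M]/(real_mx R M) defM.
Qed.

(** Reindexing the rows of [X] and the columns of [Y] keeps the inner dimension. [f] and [g] may
    repeat indices, so blow-ups are covered. *)
Lemma binary_rank_mxsub (R : realType) (n : nat) (f g : 'I_n -> 'I_n)
    (M : 'M[bool]_n) (d : nat) :
  (binary_rank R M <= d)%N -> (binary_rank R (mxsub f g M) <= d)%N.
Proof.
case/binary_rank_leP => r le_rd /existsP[X /existsP[Y /eqP defM]].
apply/binary_rank_leP; exists r => //.
apply/existsP; exists (rowsub f X); apply/existsP; exists (colsub g Y).
apply/eqP/matrixP => i j; have /matrixP/(_ (f i) (g j)) := defM.
by rewrite !mxE => ->; apply: eq_bigr => k _; rewrite !mxE.
Qed.

Definition separated {n : nat} (M : 'M[bool]_n) (A B : {set 'I_n}) : Prop :=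
  {in A &, forall a a', {in B, forall b, M a b = M a' b} -> a = a'}.

(** A row of [N] is determined by the same row of [X], one of at most [2 ^ d] boolean vectors. *)
Lemma separated_card_le (R : realType) (n d : nat) (M N : 'M[bool]_n)
    (A B : {set 'I_n}) :
    (binary_rank R N <= d)%N -> {in A & B, forall i j, N i j = M i j} ->
  separated M A B -> (#|A| <= 2 ^ d)%N.
Proof.
case/binary_rank_leP => r le_rd /existsP[X /existsP[Y /eqP defN]] eqNM sepA.
suff injX: {in A &, injective (fun i => row i X)}.
  rewrite -(card_in_imset injX).
  apply: leq_trans (max_card _) _.
  by rewrite card_mx card_bool mul1n leq_exp2l // .
move=> a a' Aa Aa' eqX; apply: (sepA a a') => // b Bb.
rewrite -!eqNM //; have /matrixP Nij := defN.
have: (N a b)%:R = (N a' b)%:R :> R.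
  move: (Nij a b) (Nij a' b); rewrite !mxE => -> ->.
  apply: eq_bigr => k _; rewrite !mxE; congr (_%:R * _).
  by move/rowP/(_ k): eqX; rewrite !mxE => ->.
by move/eqP; rewrite eqr_nat; case: (N a b); case: (N a' b).
Qed.

(** * States and their completability *)

Definition state (n : nat) : finType := ({set 'I_n} * {set 'I_n})%type.

Definition size_state {n : nat} (S : state n) : nat := (#|S.1| + #|S.2|)%N.

(** Asking for a square completion avoids ranks of rectangular submatrices. A matrix of binary rank
    at most [d] is its own completion, whence one-sided error. *)
Definition consistent (R : realType) {n : nat} (d : nat) (S : state n)
    (M : 'M[bool]_n) : bool :=
  [exists N : 'M[bool]_n, (binary_rank R N <= d)%N &&
     [forall i in S.1, forall j in S.2, N i j == M i j]].

Lemma consistentP (R : realType) (n d : nat) (S : state n) (M : 'M[bool]_n) :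
  reflect (exists2 N : 'M[bool]_n, (binary_rank R N <= d)%N &
             {in S.1 & S.2, forall i j, N i j = M i j})
          (consistent R d S M).
Proof.
apply: (iffP existsP) => [[N /andP[rkN /forall_inP eqNM]] | [N rkN eqNM]].
  by exists N => // i j Ai Bj; move/forall_inP/(_ j Bj)/eqP: (eqNM i Ai).
exists N; rewrite rkN; apply/forall_inP => i Ai; apply/forall_inP => j Bj.
by rewrite eqNM.
Qed.

Lemma consistent_sub (R : realType) (n d : nat) (S T : state n)
    (M K : 'M[bool]_n) :
    S.1 \subset T.1 -> S.2 \subset T.2 ->
    {in S.1 & S.2, forall i j, K i j = M i j} ->
  consistent R d T K -> consistent R d S M.
Proof.
move=> /subsetP sub1 /subsetP sub2 eqKM /consistentP[N rkN eqNM].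
apply/consistentP; exists N => // i j Si Sj.
by rewrite eqNM ?sub1 ?sub2 // eqKM.
Qed.

(** * Representatives and growth of a state *)

Definition rep {n : nat} (M : 'M[bool]_n) (A B : {set 'I_n}) (i : 'I_n) :
    option 'I_n :=
  [pick a in A | [forall b in B, M i b == M a b]].

Variant rep_spec (n : nat) (M : 'M[bool]_n) (A B : {set 'I_n}) (i : 'I_n) :
    option 'I_n -> Type :=
  | RepSome a of a \in A & {in B, forall b, M i b = M a b} :
      rep_spec n M A B i (Some a)
  | RepNone of (forall a, a \in A -> ~ {in B, forall b, M i b = M a b}) :
      rep_spec n M A B i None.

Lemma repP (n : nat) (M : 'M[bool]_n) (A B : {set 'I_n}) (i : 'I_n) :
  rep_spec n M A B i (rep M A B i).
Proof.
rewrite /rep; case: pickP => [a /andP[Aa /forall_inP eqM] | noM].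
  by apply: RepSome => // b Bb; apply/eqP/eqM.
apply: RepNone => a Aa eqM; move: (noM a); rewrite /= Aa /=.
by move/negbT/forall_inP; apply => b Bb; apply/eqP/eqM.
Qed.

Definition progress {n : nat} (M : 'M[bool]_n) (S : state n)
    (w : 'I_n * 'I_n) : bool :=
  match rep M S.1 S.2 w.1, rep M^T S.2 S.1 w.2 with
  | Some a, Some b => M w.1 w.2 != M a b
  | _, _ => true
  end.

(** In the last case both indices must join: [w.1] agrees with [a] on [S.2] and [w.2] with [b] on
    [S.1], so each is told apart only by the other. *)
Definition extend {n : nat} (M : 'M[bool]_n) (S : state n)
    (w : 'I_n * 'I_n) : state n :=
  match rep M S.1 S.2 w.1, rep M^T S.2 S.1 w.2 with
  | None, _ => (w.1 |: S.1, S.2)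
  | Some _, None => (S.1, w.2 |: S.2)
  | Some a, Some b =>
      if M w.1 w.2 == M a b then S else (w.1 |: S.1, w.2 |: S.2)
  end.

Definition separated_state {n : nat} (M : 'M[bool]_n) (S : state n) : Prop :=
  separated M S.1 S.2 /\ separated M^T S.2 S.1.

Lemma separatedS (n : nat) (M : 'M[bool]_n) (A B B' : {set 'I_n}) :
  B \subset B' -> separated M A B -> separated M A B'.
Proof.
move=> /subsetP subB sepA a a' Aa Aa' eqM; apply: sepA => // b Bb.
exact/eqM/subB.
Qed.

Lemma separatedU1 (n : nat) (M : 'M[bool]_n) (A B : {set 'I_n}) (i : 'I_n) :
    (forall a, a \in A -> ~ {in B, forall b, M i b = M a b}) ->
  separated M A B -> separated M (i |: A) B.
Proof.
move=> newi sepA a a' /setU1P[->|Aa] /setU1P[->|Aa'] // eqM.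
- by case: (newi a' Aa').
- by case: (newi a Aa) => b Bb; rewrite eqM.
- exact: sepA.
Qed.

(* [i] agrees on [B] with [a] only, and [j] tells [i] and [a] apart. *)
Lemma separatedU1U1 (n : nat) (M : 'M[bool]_n) (A B : {set 'I_n})
    (i j a b : 'I_n) :
    a \in A -> {in B, forall b, M i b = M a b} -> M a j = M a b ->
    M i j != M a b ->
  separated M A B -> separated M (i |: A) (j |: B).
Proof.
move=> Aa eqia eqj neq sepA; apply: separatedU1; last first.
  by apply: separatedS sepA; apply: subsetUr.
move=> a' Aa' eqM; have eq_aa' : a = a'.
  apply: sepA => // b' Bb'; rewrite -eqia // eqM //.
  by rewrite inE Bb' orbT.
by move/negP: neq; rewrite eqM ?setU11 // -eq_aa' eqj.
Qed.

Lemma extend_separated (n : nat) (M : 'M[bool]_n) (S : state n)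
    (w : 'I_n * 'I_n) :
  separated_state M S -> separated_state M (extend M S w).
Proof.
case: S w => A B [i j] [/= sepA sepB]; rewrite /extend /=.
case: repP => [a Aa eqa | newi]; last first.
  split=> /=; first exact: separatedU1.
  by apply: separatedS sepB; apply: subsetUr.
case: repP => [b Bb eqb | newj]; last first.
  split=> /=; last exact: separatedU1.
  by apply: separatedS sepA; apply: subsetUr.
case: eqP => [// | /eqP neq]; split=> /=.
  by apply: (@separatedU1U1 _ _ _ _ _ _ a b) => //; have := eqb a Aa; rewrite !mxE.
by apply: (@separatedU1U1 _ _ _ _ _ _ b a) => //; rewrite !mxE // eqa.
Qed.

Lemma sub_extend (n : nat) (M : 'M[bool]_n) (S : state n) (w : 'I_n * 'I_n) :
  S.1 \subset (extend M S w).1 /\ S.2 \subset (extend M S w).2.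
Proof.
rewrite /extend; case: (rep M _ _ _) => [a|]; last by rewrite subsetUr.
case: (rep M^T _ _ _) => [b|]; last by rewrite subsetUr.
by case: eqP; rewrite ?subsetUr.
Qed.

Lemma extend_sub (n : nat) (M : 'M[bool]_n) (S : state n) (w : 'I_n * 'I_n) :
  (extend M S w).1 \subset w.1 |: S.1 /\ (extend M S w).2 \subset w.2 |: S.2.
Proof.
rewrite /extend; case: (rep M _ _ _) => [a|]; last by rewrite subsetUr.
case: (rep M^T _ _ _) => [b|]; last by rewrite subsetUr.
by case: eqP; rewrite ?subsetUr.
Qed.

Lemma size_extend (n : nat) (M : 'M[bool]_n) (S : state n) (w : 'I_n * 'I_n) :
    separated_state M S ->
  (size_state S + progress M S w <= size_state (extend M S w))%N.
Proof.
case: S w => A B [i j] [/= sepA _]; rewrite /size_state /progress /extend /=.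
case: repP => [a Aa eqa | newi]; last first.
  rewrite /= cardsU1 (_ : i \in A = false) //=; first by lia.
  by apply/negP => /newi; apply.
case: repP => [b Bb eqb | newj] /=; last first.
  rewrite cardsU1 (_ : j \in B = false) //=; first by lia.
  by apply/negP => /newj; apply.
case: eqP => [_ | neq] /=; first by rewrite addn0.
rewrite !cardsU1 (_ : i \in A = false) //=; first by lia.
(* Were [i] in [A], column [j] would agree with column [b] there, giving [M i j = M i b = M a b]. *)
apply/negP => Ai; apply: neq; have := eqb i Ai; rewrite !mxE => ->.
exact: eqa.
Qed.

(** [extend] reads no other entries, so a tester can run it on the answers it has recorded. *)
Lemma eq_extend (n : nat) (M K : 'M[bool]_n) (S : state n)
    (w : 'I_n * 'I_n) :
    {in w.1 |: S.1 & w.2 |: S.2, forall i j, K i j = M i j} ->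
  extend K S w = extend M S w.
Proof.
case: S w => A B [i j] /= eqKM.
have inA a : a \in A -> a \in i |: A by move=> Aa; rewrite inE Aa orbT.
have inB b : b \in B -> b \in j |: B by move=> Bb; rewrite inE Bb orbT.
have eqr : rep K A B i = rep M A B i.
  apply: eq_pick => a /=; case Aa: (a \in A) => //=.
  by apply: eq_forallb_in => b Bb; rewrite !eqKM ?setU11 ?inA ?inB.
have eqc : rep K^T B A j = rep M^T B A j.
  apply: eq_pick => b /=; case Bb: (b \in B) => //=.
  by apply: eq_forallb_in => a Aa; rewrite !mxE !eqKM ?setU11 ?inA ?inB.
rewrite /extend /= eqr eqc.
case: repP => [a Aa _|//]; case: repP => [b Bb _|//].
by rewrite !eqKM ?setU11 ?inA ?inB.
Qed.

(* Sampled pairs making no progress agree with the blow-up of [N] along the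
   representatives, a matrix of binary rank at most [d]. *)
Lemma progress_ge (R : realType) (n d : nat) (eps : R) (M : 'M[bool]_n)
    (S : state n) :
    far_from_binary_rank d eps M -> consistent R d S M ->
  eps * n%:R ^+ 2 <= #|[set w | progress M S w]|%:R.
Proof.
move=> farM /consistentP[N rkN eqNM].
(* The default is arbitrary: a pair with an unrepresented index makes progress anyway. *)
pose f i := odflt i (rep M S.1 S.2 i); pose g j := odflt j (rep M^T S.2 S.1 j).
apply: le_trans (ltW (farM (mxsub f g N) (binary_rank_mxsub _ _ f g _ _ rkN))) _.
rewrite ler_nat; apply/subset_leq_card/subsetP => -[i j].
rewrite !inE !mxE /progress /f /g /=.
case: repP => [a Aa _|//]; case: repP => [b Bb _|//] /=.
by rewrite eqNM.
Qed.

Lemma consistent_size (R : realType) (n d : nat) (M : 'M[bool]_n)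
    (S : state n) :
    separated_state M S -> consistent R d S M ->
  (size_state S <= 2 ^ d.+1)%N.
Proof.
move=> [sep1 sep2] /consistentP[N rkN eqNM].
rewrite expnS mul2n -addnn leq_add //.
  exact: separated_card_le rkN eqNM sep1.
apply: separated_card_le (binary_rank_tr _ _ _ _ rkN) _ sep2 => j i Bj Ai.
by rewrite !mxE eqNM.
Qed.

(** * Counting the sample sequences that end in a consistent state *)

(* The size cap bounds the number of probes of a round; a state exceeding it is
   inconsistent by [consistent_size]. *)
Definition next_state {n : nat} (d : nat) (M : 'M[bool]_n) (S : state n)
    (w : 'I_n * 'I_n) : state n :=
  if (size_state S <= 2 ^ d.+1)%N then extend M S w else S.

Lemma sub_next_state (n d : nat) (M : 'M[bool]_n) (S : state n) (w : 'I_n * 'I_n) :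
  S.1 \subset (next_state d M S w).1 /\ S.2 \subset (next_state d M S w).2.
Proof. by rewrite /next_state; case: ifP => // _; apply: sub_extend. Qed.

Lemma next_state_sub (n d : nat) (M : 'M[bool]_n) (S : state n) (w : 'I_n * 'I_n) :
  (next_state d M S w).1 \subset w.1 |: S.1 /\ (next_state d M S w).2 \subset w.2 |: S.2.
Proof.
by rewrite /next_state; case: ifP => _; [apply: extend_sub | rewrite !subsetUr].
Qed.

(** Places the final state inside the submatrix read by the nonadaptive tester. *)
Lemma foldl_next_state_sub (n d : nat) (M : 'M[bool]_n) (S : state n)
    (ws : seq ('I_n * 'I_n)) :
  (foldl (next_state d M) S ws).1 \subset S.1 :|: [set i in map fst ws] /\
  (foldl (next_state d M) S ws).2 \subset S.2 :|: [set j in map snd ws].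
Proof.
elim: ws S => [|w ws IHws] S /=; first by rewrite !subsetUl.
have [sub1 sub2] := IHws (next_state d M S w); have [nsub1 nsub2] := next_state_sub n d M S w.
rewrite !set_cons !setUA ![_ :|: [set _]]setUC.
by split; [apply: subset_trans sub1 _ | apply: subset_trans sub2 _];
  apply: setSU.
Qed.

(* Markov's inequality for the time at which [alive] fails, the expected number
   of remaining rounds being at most [fuel S * #|X| / G]. *)
Lemma alive_count_le (R : realFieldType) (X : finType) (T : Type)
    (step : T -> X -> T) (inv : T -> Prop) (alive : pred T) (fuel : T -> nat)
    (good : T -> pred X) (G : R) :
    0 <= G ->
    (forall S x, inv S -> inv (step S x)) ->
    (forall S x, alive (step S x) -> alive S) ->
    (forall S x, inv S -> alive S -> (fuel (step S x) + good S x <= fuel S)%N) ->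
    (forall S, inv S -> alive S -> G <= #|[set x | good S x]|%:R) ->
  forall (k : nat) (S : T), inv S ->
    k%:R * G * (\sum_(w : k.-tuple X) alive (foldl step S w))%:R
      <= (fuel S * #|X| ^ k.+1)%:R.
Proof.
move=> G_ge0 invS aliveS fuelS goodS; elim=> [|k IHk] S iS; first by rewrite !mul0r.
have [aS | dS] := boolP (alive S); last first.
  rewrite big1 ?mulr0 ?ler0n // => w _.
  have dead (s : seq X) : forall S', ~~ alive S' -> ~~ alive (foldl step S' s).
    elim: s => //= x s IHs S' dS'; apply: IHs; apply: contra dS'; exact: aliveS.
  by rewrite (negbTE (dead w S dS)).
set c := (\sum_w _)%N.
(* Condition on the first sample. *)
have defc : c = (\sum_x \sum_(w : k.-tuple X) alive (foldl step (step S x) w))%N.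
  rewrite pair_bigA /= /c.
  rewrite (reindex (fun p : X * k.-tuple X => [tuple of p.1 :: p.2])) //=.
  exists (fun w : k.+1.-tuple X => (thead w, [tuple of behead w])) => [[x w] _ | w _] /=.
    by rewrite theadE; congr pair; apply: val_inj.
  by rewrite -tuple_eta.
have le_c : (c <= #|X| ^ k.+1)%N.
  rewrite -card_tuple -sum1_card; apply: leq_sum => w _; exact: leq_b1.
have le_sum : k%:R * G * c%:R <= ((\sum_x fuel (step S x)) * #|X| ^ k.+1)%:R.
  rewrite defc big_distrl /= !natr_sum mulr_sumr; apply: ler_sum => x _.
  exact/IHk/invS.
have le_fuel : (\sum_x fuel (step S x) + #|[set x | good S x]| <= fuel S * #|X|)%N.
  have -> : #|[set x | good S x]| = (\sum_x good S x)%N.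
    by rewrite -sum1dep_card big_mkcond; apply: eq_bigr => x _; case: (good S x).
  rewrite -big_split /= mulnC -sum_nat_const.
  by apply: leq_sum => x _; apply: fuelS.
(* Split [k + 1] rounds: induction bounds the last [k], and the first costs [G * c], paid for by the
   good samples. *)
rewrite -natr1 mulrDl mul1r mulrDl expnS mulnA.
apply: le_trans (_ : ((\sum_x fuel (step S x) + #|[set x | good S x]|) * #|X| ^ k.+1)%:R <= _).
  rewrite mulnDl natrD lerD // natrM; apply: ler_pM => //.
    exact: goodS.
  by rewrite ler_nat.
by rewrite ler_nat leq_mul2r le_fuel orbT.
Qed.

Lemma consistent_count_le (R : realType) (n d k : nat) (eps : R)
    (M : 'M[bool]_n) :
    (0 < n)%N -> 0 <= eps -> far_from_binary_rank d eps M ->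
  k%:R * eps *
      (\sum_(w : k.-tuple ('I_n * 'I_n)%type)
          consistent R d (foldl (next_state d M) (set0, set0) w) M)%:R
    <= (2 ^ d.+1).+1%:R * ((n * n) ^ k)%:R.
Proof.
move=> n_gt0 eps_ge0 farM.
have n2_gt0 : 0 < n%:R ^+ 2 :> R by rewrite exprn_gt0 // ltr0n.
set c := (\sum_w _)%N; pose X : finType := ('I_n * 'I_n)%type.
(* The extra unit lets a consistent state of maximal size still pay for a step that makes it
   inconsistent. *)
pose fuel (S : state n) := ((2 ^ d.+1).+1 - size_state S)%N.
have bound : k%:R * (eps * n%:R ^+ 2) * c%:R
    <= (fuel (set0, set0) * #|X| ^ k.+1)%:R.
  apply: (alive_count_le _ X _ _ (separated_state M)
    (fun S => consistent R d S M) fuel (progress M)).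
  - exact: mulr_ge0 (ltW n2_gt0).
  - move=> S w; rewrite /next_state; case: ifP => // _; exact: extend_separated.
  - move=> S w; have [sub1 sub2] := sub_next_state n d M S w.
    exact: consistent_sub.
  - move=> S w sepS conS; have szS := consistent_size R n d M S sepS conS.
    by rewrite /next_state szS /fuel; have := size_extend n M S w sepS; lia.
  - by move=> S _; apply: progress_ge.
  - by split=> a a' /=; rewrite inE.
rewrite -(ler_pM2r n2_gt0); move: bound.
rewrite /fuel /size_state /= !cards0 subn0 card_prod card_ord [(_ ^ k.+1)%N]expnS.
by rewrite !natrM -expr2 => bound; lra.
Qed.

(** * Query trees that record their answers *)

Definition set_entry {n : nat} (K : 'M[bool]_n) (p : 'I_n * 'I_n) (b : bool) :
    'M[bool]_n :=
  \matrix_(i, j) if (i, j) == p then b else K i j.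

(** [cont] sees only the record [K] of the answers, never the input matrix itself. *)
Fixpoint query_all {n : nat} (s : seq ('I_n * 'I_n)) (K : 'M[bool]_n)
    (cont : 'M[bool]_n -> query_tree n) : query_tree n :=
  if s is p :: s' then
    Query p (query_all s' (set_entry K p false) cont)
            (query_all s' (set_entry K p true) cont)
  else cont K.

Definition learn {n : nat} (M : 'M[bool]_n) (s : seq ('I_n * 'I_n))
    (K : 'M[bool]_n) : 'M[bool]_n :=
  \matrix_(i, j) if (i, j) \in s then M i j else K i j.

Lemma learn_cons (n : nat) (M K : 'M[bool]_n) (p : 'I_n * 'I_n)
    (s : seq ('I_n * 'I_n)) :
  learn M (p :: s) K = learn M s (set_entry K p (M p.1 p.2)).
Proof.
apply/matrixP => i j; rewrite !mxE inE; case: eqP => [<- | _] //=.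
by rewrite if_same.
Qed.

Lemma learn_nil (n : nat) (M K : 'M[bool]_n) : learn M [::] K = K.
Proof. by apply/matrixP => i j; rewrite mxE. Qed.

Lemma accepts_query_all (n : nat) (M K : 'M[bool]_n) (s : seq ('I_n * 'I_n))
    (cont : 'M[bool]_n -> query_tree n) :
  accepts (query_all s K cont) M = accepts (cont (learn M s K)) M.
Proof.
elim: s K => [|p s IHs] K /=; first by rewrite learn_nil.
by rewrite learn_cons; case: (M _ _); rewrite IHs.
Qed.

Lemma queried_query_all (n : nat) (M K : 'M[bool]_n) (s : seq ('I_n * 'I_n))
    (cont : 'M[bool]_n -> query_tree n) :
  queried (query_all s K cont) M = s ++ queried (cont (learn M s K)) M.
Proof.
elim: s K => [|p s IHs] K /=; first by rewrite learn_nil.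
by rewrite learn_cons; case: (M _ _); rewrite IHs.
Qed.

(** * The nonadaptive and the adaptive tester *)

Definition grid {n : nat} (ws : seq ('I_n * 'I_n)) : seq ('I_n * 'I_n) :=
  [seq (w.1, w'.2) | w <- ws, w' <- ws].

(** The initial [false] entries are harmless: the verdict reads only entries of the grid, all
    overwritten. *)
Definition grid_tree (R : realType) {n : nat} (d : nat)
    (ws : seq ('I_n * 'I_n)) : query_tree n :=
  query_all (grid ws) (const_mx false) (fun K => Halt n
    (consistent R d ([set i in map fst ws], [set j in map snd ws]) K)).

(** What [extend] reads beyond the block [S.1] by [S.2], which is already known. *)
Definition probes {n : nat} (d : nat) (S : state n) (w : 'I_n * 'I_n) :
    seq ('I_n * 'I_n) :=
  if (size_state S <= 2 ^ d.+1)%N then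
    (w.1, w.2) :: [seq (w.1, b) | b <- enum S.2] ++ [seq (a, w.2) | a <- enum S.1]
  else [::].

Fixpoint skeleton_tree (R : realType) {n : nat} (d : nat)
    (ws : seq ('I_n * 'I_n)) (S : state n) (K : 'M[bool]_n) : query_tree n :=
  if ws is w :: ws' then
    query_all (probes d S w) K (fun K' => skeleton_tree R d ws' (next_state d K' S w) K')
  else Halt n (consistent R d S K).

Lemma accepts_grid_tree (R : realType) (n d : nat) (ws : seq ('I_n * 'I_n))
    (M : 'M[bool]_n) :
  accepts (grid_tree R d ws) M =
  consistent R d ([set i in map fst ws], [set j in map snd ws]) M.
Proof.
rewrite accepts_query_all /=.
have eqM : {in [set i in map fst ws] & [set j in map snd ws],
    forall i j, learn M (grid ws) (const_mx false) i j = M i j}.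
  move=> i j; rewrite !inE mxE => /mapP[w ws_w ->] /mapP[w' ws_w' ->].
  by rewrite ifT //; apply/allpairsP; exists (w, w').
by apply/idP/idP; apply: consistent_sub => //= i j Ai Bj; rewrite eqM.
Qed.

(** Invariant: the record is exact on the current block. The probes complete it on the enlarged
    block, so the tree follows the process run on [M]. *)
Lemma accepts_skeleton_tree (R : realType) (n d : nat)
    (ws : seq ('I_n * 'I_n)) (S : state n) (M K : 'M[bool]_n) :
    {in S.1 & S.2, forall i j, K i j = M i j} ->
  accepts (skeleton_tree R d ws S K) M =
  consistent R d (foldl (next_state d M) S ws) M.
Proof.
elim: ws S K => [|w ws IHws] S K eqKM /=.
  by apply/idP/idP; apply: consistent_sub => //= i j Ai Bj; rewrite eqKM.
rewrite accepts_query_all.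
set K' := learn M _ K.
have eqK' : {in S.1 & S.2, forall i j, K' i j = M i j}.
  by move=> i j Ai Bj; rewrite mxE eqKM // if_same.
suff [-> eqnext] : next_state d K' S w = next_state d M S w /\
    {in (next_state d M S w).1 & (next_state d M S w).2, forall i j, K' i j = M i j}.
  exact: IHws.
rewrite /next_state; case: ifP => // le_size.
suff eqU : {in w.1 |: S.1 & w.2 |: S.2, forall i j, K' i j = M i j}.
  split; first exact: eq_extend.
  have [/subsetP sub1 /subsetP sub2] := extend_sub n M S w.
  by move=> i j /sub1 Ai /sub2 Bj; apply: eqU.
move=> i j /setU1P[->|Ai] /setU1P[->|Bj]; last exact: eqK'.
all: rewrite mxE ifT // /probes le_size inE mem_cat; apply/orP.
- by left.
- by right; apply/orP; left; apply: map_f; rewrite mem_enum.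
- by right; apply/orP; right; apply: (map_f (fun a => (a, w.2))); rewrite mem_enum.
Qed.

Lemma size_queried_skeleton_tree (R : realType) (n d : nat)
    (ws : seq ('I_n * 'I_n)) (S : state n) (M K : 'M[bool]_n) :
  (size (queried (skeleton_tree R d ws S K) M) <= size ws * (2 ^ d.+1).+1)%N.
Proof.
elim: ws S K => [|w ws IHws] S K //=.
rewrite queried_query_all size_cat mulSn leq_add //.
rewrite /probes; case: ifP => //= le_size.
by rewrite size_cat !size_map -!cardE ltnS addnC.
Qed.

(** * Uniform sampling, number of rounds and error probability *)

Lemma uniform_prob_sum1 (R : realType) (T : finType) :
  (0 < #|T|)%N -> \sum_(w : T) (#|T|%:R^-1 : R) = 1.
Proof.
by move=> T_gt0; rewrite sumr_const -[_ *+ _]mulr_natl divff // pnatr_eq0 -lt0n.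
Qed.

Lemma uniform_prob_ge0 (R : realType) (T : finType) (w : T) :
  0 <= #|T|%:R^-1 :> R.
Proof. by rewrite invr_ge0. Qed.

Definition uniform_algorithm (R : realType) (n : nat) (T : finType)
    (T_gt0 : (0 < #|T|)%N) (t : T -> query_tree n) : randomized_algorithm R n :=
  @RandomizedAlgorithm R n T (fun=> #|T|%:R^-1)
    (uniform_prob_ge0 R T) (uniform_prob_sum1 R T T_gt0) t.

(* For [n = 0] there is no pair to sample, and for [eps >= 1] no matrix is far;
   the latter case must cost no query as [eps] is unbounded. *)
Definition rounds (R : realType) (n d : nat) (eps : R) : nat :=
  if (0 < n)%N && (eps < 1) then (Num.truncn (9%:R * 2%:R ^+ d / eps)).+1
  else 0.

Lemma card_samples_gt0 (R : realType) (n d : nat) (eps : R) :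
  (0 < #|{: (rounds R n d eps).-tuple ('I_n * 'I_n)}|)%N.
Proof.
rewrite card_tuple card_prod card_ord /rounds; case: n => [|n] /=.
  by rewrite expn0.
by rewrite expn_gt0 muln_gt0.
Qed.

(** The round added to the truncation is absorbed by [1 <= 2 ^ d / eps], turning 9 into 10. *)
Lemma rounds_le (R : realType) (n d : nat) (eps : R) :
  0 < eps -> (rounds R n d eps)%:R <= 10%:R * 2%:R ^+ d / eps.
Proof.
move=> eps_gt0; have pow_ge1 : 1 <= 2%:R ^+ d :> R.
  by rewrite exprn_ege1 // ler1n.
have pow_ge0 := le_trans ler01 pow_ge1.
rewrite /rounds; case: ifP => [/andP[_ eps_lt1]|_]; last first.
  by rewrite divr_ge0 ?mulr_ge0 // ltW.
have arg_ge0 : 0 <= 9%:R * 2%:R ^+ d / eps.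
  by rewrite divr_ge0 ?mulr_ge0 // ltW.
have /truncn_itv/andP[le_trunc _] := arg_ge0.
have one_le : 1 <= 2%:R ^+ d / eps.
  by rewrite ler_pdivlMr // mul1r (le_trans (ltW eps_lt1)).
by rewrite -natr1; move: le_trunc one_le; rewrite -!mulrA; lra.
Qed.

(** The initial fuel [2 ^ d.+1 + 1] is at most [3 * 2 ^ d], so the factor 9 makes the survival
    probability at most 1/3. *)
Lemma rounds_gt (R : realType) (n d : nat) (eps : R) :
    0 < eps -> (0 < n)%N -> eps < 1 ->
  9%:R * 2%:R ^+ d <= (rounds R n d eps)%:R * eps.
Proof.
move=> eps_gt0 n_gt0 eps_lt1; rewrite /rounds n_gt0 eps_lt1 /=.
by rewrite -ler_pdivrMr // ltW // truncnS_gt.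
Qed.

(** The zero matrix has binary rank 0 and lies within distance [n ^ 2] of [M]. *)
Lemma far_nondegenerate (R : realType) (n d : nat) (eps : R)
    (M : 'M[bool]_n) :
  far_from_binary_rank d eps M -> (0 < n)%N /\ eps < 1.
Proof.
move=> farM; pose N : 'M[bool]_n := const_mx false.
have rkN : (binary_rank R N <= d)%N.
  apply/binary_rank_leP; exists 0 => //.
  apply/existsP; exists (const_mx false); apply/existsP; exists (const_mx false).
  by apply/eqP/matrixP => i j; rewrite !mxE big_ord0.
have /lt_le_trans lt_n2 := farM N rkN.
have {}lt_n2 : eps * n%:R ^+ 2 < n%:R ^+ 2.
  apply: lt_n2; rewrite -natrX ler_nat; apply: leq_trans (max_card _) _.
  by rewrite card_prod card_ord.
have n_gt0 : (0 < n)%N.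
  by case: (n) lt_n2 => // ; rewrite expr0n /= mulr0 ltxx.
split=> //; move: lt_n2; rewrite -[X in _ < X]mul1r ltr_pM2r //.
by rewrite exprn_gt0 // ltr0n.
Qed.

(** Shared by both testers: on far inputs it suffices that acceptance forces a consistent final
    state. *)
Lemma uniform_tester (R : realType) (n d : nat) (eps : R)
    (t : (rounds R n d eps).-tuple ('I_n * 'I_n)%type -> query_tree n) :
    0 < eps ->
    (forall w M, (binary_rank R M <= d)%N -> accepts (t w) M) ->
    (forall w M, accepts (t w) M ->
       consistent R d (foldl (next_state d M) (set0, set0) w) M) ->
  one_sided_tester d eps (uniform_algorithm R n _ (card_samples_gt0 R n d eps) t).
Proof.
move=> eps_gt0 complete_t sound_t; split=> M.
  move=> rkM; rewrite /prob_accept -[RHS](uniform_prob_sum1 _ _ (card_samples_gt0 R n d eps)).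
  by apply: eq_bigl => w; apply: complete_t.
move=> farM; have [n_gt0 eps_lt1] := far_nondegenerate _ _ _ _ _ farM.
set A := uniform_algorithm _ _ _ _ _.
have split1 : prob_accept A M + prob_reject A M = 1.
  rewrite -(@seed_prob_sum1 _ _ A) /prob_accept /prob_reject.
  by rewrite [RHS](bigID (fun w => accepts (run w) M)).
suff : prob_accept A M <= 3%:R^-1 by lra.
set k := rounds R n d eps in t complete_t sound_t A split1 *.
pose c := (\sum_(w : k.-tuple ('I_n * 'I_n)%type)
   consistent R d (foldl (next_state d M) (set0, set0) w) M)%N.
pose q : R := ((n * n) ^ k)%:R.
have q_gt0 : 0 < q by rewrite ltr0n expn_gt0 muln_gt0 n_gt0.
have le_c : prob_accept A M <= c%:R / q.
  rewrite /prob_accept /= sumr_const card_tuple card_prod card_ord.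
  rewrite -/q -[_ *+ _]mulr_natl ler_pM2r ?invr_gt0 // ler_nat.
  rewrite -sum1_card big_mkcond; apply: leq_sum => w _.
  by rewrite unfold_in /=; case: ifP => // /sound_t ->.
apply: le_trans le_c _; rewrite ler_pdivrMr //.
have := consistent_count_le R n d k eps M n_gt0 (ltW eps_gt0) farM.
have := rounds_gt R n d eps eps_gt0 n_gt0 eps_lt1.
rewrite -/c -/q -/k; set ke := k%:R * eps => le_ke le_keq.
have pow_ge1 : 1 <= 2%:R ^+ d :> R by rewrite exprn_ege1 // ler1n.
have le_pow : (2 ^ d.+1).+1%:R <= 3%:R * 2%:R ^+ d :> R.
  by rewrite -natr1 natrX exprS; lra.
have pow_gt0 : 0 < 9%:R * 2%:R ^+ d :> R by lra.
rewrite -(ler_pM2l pow_gt0).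
apply: le_trans (ler_wpM2r (ler0n _ _) le_ke) _.
apply: le_trans le_keq _; apply: le_trans (ler_wpM2r (ltW q_gt0) le_pow) _.
by rewrite mulrA ler_pM2r // -mulrA [_ * 3%:R^-1]mulrC; lra.
Qed.

Theorem theorem2 (R : realType) :
  (exists (A : forall (n d : nat) (eps : R), randomized_algorithm R n) (C : R),
     0 < C /\
     forall (n d : nat) (eps : R), 0 < eps ->
       [/\ one_sided_tester d eps (A n d eps),
           nonadaptive (A n d eps) &
           query_complexity_le (A n d eps) (C * (2%:R ^+ (2 * d) / eps ^+ 2))])
  /\
  (exists (A : forall (n d : nat) (eps : R), randomized_algorithm R n) (C : R),
     0 < C /\
     forall (n d : nat) (eps : R), 0 < eps ->
       one_sided_tester d eps (A n d eps) /\
       query_complexity_le (A n d eps) (C * (2%:R ^+ (2 * d) / eps))).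
Proof.
split.
  exists (fun n d eps => uniform_algorithm R n _ (card_samples_gt0 R n d eps)
    (fun w => grid_tree R d w)), 100%:R; split=> // n d eps eps_gt0; split.
  - apply: uniform_tester => // w M; rewrite accepts_grid_tree.
      by move=> rkM; apply/consistentP; exists M.
    (* A completion of the sampled submatrix also completes the final state inside it. *)
    have [sub1 sub2] := foldl_next_state_sub n d M (set0, set0) w.
    by rewrite !set0U in sub1 sub2; apply: consistent_sub.
  - by move=> w M N /=; rewrite !queried_query_all.
  - move=> w M /=; rewrite queried_query_all size_cat addn0 size_allpairs.
    rewrite size_tuple natrM.
    (* The grid has one entry per pair of rounds, so the bound on [rounds] is squared. *)
    have -> : 100%:R * (2%:R ^+ (2 * d) / eps ^+ 2) =
        (10%:R * 2%:R ^+ d / eps) * (10%:R * 2%:R ^+ d / eps) :> R.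
      by rewrite mulnC exprM !expr2 invfM; lra.
    by rewrite ler_pM // rounds_le.
exists (fun n d eps => uniform_algorithm R n _ (card_samples_gt0 R n d eps)
  (fun w => skeleton_tree R d w (set0, set0) (const_mx false))), 30%:R.
split=> // n d eps eps_gt0; split.
  apply: uniform_tester => // w M; rewrite accepts_skeleton_tree //.
  - by move=> rkM; apply/consistentP; exists M.
  - by move=> i j; rewrite inE.
  - by move=> i j; rewrite inE.
move=> w M /=; apply: le_trans (_ : (size w * (2 ^ d.+1).+1)%:R <= _).
  by rewrite ler_nat size_queried_skeleton_tree.
rewrite size_tuple natrM.
(* Ten from the number of rounds, three from the at most [2 ^ d.+1 + 1 <= 3 * 2 ^ d] probes in
   each. *)
have -> : 30%:R * (2%:R ^+ (2 * d) / eps) =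
    (10%:R * 2%:R ^+ d / eps) * (3%:R * 2%:R ^+ d) :> R.
  by rewrite mulnC exprM expr2; lra.
rewrite ler_pM // ?rounds_le // -natr1 natrX exprS.
have pow_ge1 : 1 <= 2%:R ^+ d :> R by rewrite exprn_ege1 // ler1n.
lra.
Qed.
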